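(* Let $\Sigma$ be a finite alphabet, let $\mathcal M\subset\mathcal M(\Sigma)$ be a compact, transition complete and in-complete set, and let $\bigcup_{N\in\mathbb Z_+}\mathcal M_N$ be its measure $\lambda$-graph system. Let $X\subset\Sigma^{\mathbb Z}$ be the subshift presented by $\bigcup_{N\in\mathbb Z_+}\mathcal M_N$, and suppose that $\bigcup_{N\in\mathbb Z_+}\mathcal M_N$ is contractive. Then $X$ has a $g$-function $g$ such that $\mathcal M_N=\mathcal M_N(X,g)$ for all $N\in\mathbb Z_+$.
   Context: Subshifts. A subshift $X\subset\Sigma^{\mathbb Z}$ is a closed shift-invariant set; a finite word is admissible if it appears in a point of $X$; $X$ is determined by its admissible words. For an interval $I$ of integers, $X_I=\{(x_j)_{j\in I}:x\in X\}$ with the product topology. For $x^-\in X_{(-\infty,0]}$ and $n\in\mathbb N$, $\Gamma_n^+(x^-)=\{b\in X_{[1,n]}:(x^-,b)\in X_{(-\infty,n]}\}$. $g$-functions. A $g$-function for $X$ is a continuous mapping $g:\{(x^-,\sigma)\in X_{(-\infty,0]}\times\Sigma:\sigma\in\Gamma_1^+(x^-)\}\to[0,1]$ such that $\sum_{\alpha\in\Gamma_1^+(x^-)}g(x^-,\alpha)=1$ for all $x^-\in X_{(-\infty,0]}$. Given $g$, for $x^-\in X_{(-\infty,0]}$ and $N\in\mathbb N$ let $\mu_N(x^-)$ be the probability vector on $\Sigma^N$ with $\mu_N(x^-)(a)=\prod_{1\le k\le N}g((x^-,a_{[1,k)}),a_k)$ for $a\in\Gamma_N^+(x^-)$ (with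 $(x^-,a_{[1,k)})$ regarded, after shifting indices, as an element of $X_{(-\infty,0]}$), and $\mu_N(x^-)(a)=0$ otherwise. Put $\mathcal M_N(X,g)=\{\mu_N(x^-):x^-\in X_{(-\infty,0]}\}$ for $N\in\mathbb N$, and $\mathcal M_0(X,g)=\{\emptyset\}$. Measure $\lambda$-graph systems. $\mathcal M(\Sigma)$ is the set of Borel probability measures on $\Sigma^{\mathbb N}$ with the weak* topology; $C(a)\subset\Sigma^{\mathbb N}$ is the cylinder of sequences beginning with the word $a$. For $\sigma\in\Sigma$ and $\mu\in\mathcal M(\Sigma)$ with $\mu(C(\sigma))>0$, $\tau_\sigma(\mu)\in\mathcal M(\Sigma)$ is given by $\tau_\sigma(\mu)(C(b))=\mu(C(\sigma b))/\mu(C(\sigma))$; there is then an edge labeled $\sigma$ from $\mu$ to $\tau_\sigma(\mu)$. Similarly, let $\mathcal M_N(\Sigma)$ be the set of probability vectors on $\Sigma^N$ ($N\ge1$) and $\mathcal M_0(\Sigma)=\{\emptyset\}$ (a single vertex). For $N\geq 1$ and $\mu\in\mathcal M_N(\Sigma)$ giving positive mass $\mu(\{a\in\Sigma^N: a_1=\sigma\})$ to words beginning with $\sigma$, $\tau_\sigma(\mu)\in\mathcal M_{N-1}(\Sigma)$ is $\tau_\sigma(\mu)(b)=\mu(\sigma b)/\mu(\{a\in\Sigma^N:a_1=\sigma\})$ if $N>1$, and $\tau_\sigma(\mu)=\emptyset$ if $N=1$; there is then an edge labeled $\sigma$ from $\mu$ to $\tau_\sigma(\mu)$. For a word $a=a_1\dots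 a_n$ set $\tau_a=\tau_{a_n}\circ\cdots\circ\tau_{a_1}$ wherever defined. A set $\mathcal M\subset\mathcal M(\Sigma)$ is transition complete if $\mu\in\mathcal M$, $\sigma\in\Sigma$, $\mu(C(\sigma))>0$ imply $\tau_\sigma(\mu)\in\mathcal M$; it is in-complete if for every $\mu\in\mathcal M$ there are $\nu\in\mathcal M$ and $\sigma\in\Sigma$ with $\nu(C(\sigma))>0$ and $\tau_\sigma(\nu)=\mu$. For a transition complete and in-complete $\mathcal M$, its measure $\lambda$-graph system is the labeled directed graph with vertex set $\bigcup_{N\in\mathbb Z_+}\mathcal M_N$, where for $N\ge 1$ $\mathcal M_N\subset\mathcal M_N(\Sigma)$ is the set of marginals on the first $N$ coordinates of the measures in $\mathcal M$, and $\mathcal M_0=\{\emptyset\}$, with edges given by the $\tau_\sigma$. It presents a subshift $X$ if the set of admissible words of $X$ coincides with the set of label sequences of finite paths in it. Contractivity. A measure $\lambda$-graph system $\bigcup_N\mathcal M_N$ presenting $X$ is contractive if for all $x^-\in X_{(-\infty,0]}$ $$\lim_{n\to\infty}\operatorname{diam}\{\tau_{x^-_{(-n,0]}}(\mu):\mu\in\mathcal M_{n+1},\ \tau_{x^-_{(-n,0]}}(\mu)\text{ is defined}\}=0,$$ the diameter being taken in $\mathcal M_1(\Sigma)\subset\mathbb R^\Sigma$. *)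

(* Defs.v *)
From HB Require Import structures.
From mathcomp Require Import all_boot all_order all_algebra.
From mathcomp Require Import all_classical all_reals all_analysis.

Set Implicit Arguments.
Unset Strict Implicit.
Unset Printing Implicit Defensive.

Import Order.TTheory GRing.Theory Num.Theory.
Import numFieldNormedType.Exports.

Local Open Scope classical_set_scope.
Local Open Scope ring_scope.

(* The library's measurable types are pointed, so the Borel space of
   one-sided sequences over an alphabet requires a point of the alphabet. *)
#[short(type="alphabetType")]
HB.structure Definition Alphabet := {S of Finite S & Pointed S}.

Notation bi_seq S := {ptws int -> discrete_topology S}.
Notation one_seq S := {ptws nat -> discrete_topology S}.

Notation borel T := (g_sigma_algebraType (@open T)).

Section Subshifts.
Context {S : alphabetType}.
Implicit Types (X : set (bi_seq S)) (u : one_seq S).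

Definition bi_shift (x : bi_seq S) : bi_seq S := fun j => x (j + 1).

Definition subshift X := closed X /\ bi_shift @` X = X.

Definition admissible X n (a : n.-tuple S) :=
  exists2 x, X x & exists j : int, forall i : 'I_n, x (j + i%:Z) = tnth a i.

(* A left-infinite sequence x^- = (x_j)_(j <= 0) is encoded by the map
   k |-> x_(-k); in particular its value at 0 is the most recent letter. *)
Definition left_inf X : set (one_seq S) :=
  [set u | exists2 x, X x & forall k : nat, x (- k%:Z) = u k].

(* Gamma_n^+(x^-) *)
Definition follower X u n : set (n.-tuple S) :=
  [set b | exists2 x, X x & (forall k : nat, x (- k%:Z) = u k) /\
                            (forall i : 'I_n, x (i.+1%:Z) = tnth b i)].

(* (x^-, s), re-indexed by (-oo, 0] *)
Definition push u (s : S) : one_seq S := fun k => if k is k'.+1 then u k' else s.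

(* (x^-, w), re-indexed by (-oo, 0] *)
Definition extend u (w : seq S) : one_seq S := foldl push u w.

(* x^-_(-n, 0] = x_(-n+1) ... x_0 *)
Definition recent u n : n.-tuple S := [tuple u (rev_ord i) | i < n].

End Subshifts.

(* Vectors indexed by the words of length N. The vertex \emptyset of level 0
   is encoded by the only probability vector on the one-point set S^0. *)
Notation wvec R S N := {ffun N.-tuple S -> R}.

Section GFunctions.
Context {R : realType} {S : alphabetType}.
Implicit Types (X : set (bi_seq S)) (g : one_seq S * discrete_topology S -> R).

Definition gdomain X : set (one_seq S * discrete_topology S) :=
  [set p | left_inf X p.1 /\ @follower S X p.1 1 [tuple p.2]].

(* A function on the domain is represented by a function on the whole product,
   whose values outside of the domain are irrelevant. *)
Definition g_function X g :=
  [/\ {within gdomain X, continuous g},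
      forall p, gdomain X p -> 0 <= g p <= 1 &
      forall u, left_inf X u -> \sum_(s : S | `[< gdomain X (u, s) >]) g (u, s) = 1].

Definition g_vec X g N (u : one_seq S) : wvec R S N :=
  [ffun a => if `[< follower X u a >]
             then \prod_(k < N) g (extend u (take k a), tnth a k) else 0].

Definition g_vertices X g N : set (wvec R S N) :=
  if N is 0 then [set [ffun=> 1]] else @g_vec X g N @` left_inf X.

End GFunctions.

Arguments g_vertices {R S} X g N.

Section WeakStar.
Context {R : realType} {S : alphabetType}.
Implicit Types mu : probability (borel (one_seq S)) R.

Definition cylinder (a : seq S) : set (borel (one_seq S)) :=
  [set x | mkseq x (size a) = a].

Definition one_shift (x : borel (one_seq S)) : borel (one_seq S) :=
  fun k => x k.+1.

Lemma open_coordinate k (A : set S) : open [set x : one_seq S | A (x k)].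
Proof.
apply: (@open_comp _ _ (fun x : one_seq S => x k) (A : set (discrete_topology S))).
  by move=> x _; exact: (@proj_continuous nat (fun=> discrete_topology S) k x).
exact: discrete_open.
Qed.

Lemma one_shift_continuous :
  continuous (one_shift : one_seq S -> one_seq S).
Proof.
move=> x; pose coord k (y : one_seq S) : discrete_topology S := y k.
pose Tc k := Topological.class (initial_topology (coord k)).
have FF : Filter ((one_shift : one_seq S -> one_seq S) @ nbhs (x : one_seq S)).
  exact: fmap_filter.
have [_ H] := @cvg_sup (one_seq S) nat Tc _ (one_shift x) FF.
apply H => k U; rewrite (@nbhsE (initial_topology (coord k))).
move=> [V [[W oW <-] Wx] WU].
apply: (filterS WU); apply: (@open_nbhs_nbhs (one_seq S) x).
by split=> //; exact: (open_coordinate k.+1 W).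
Qed.

Lemma measurable_one_shift : measurable_fun setT one_shift.
Proof.
apply: (@measurability _ _ _ _ setT one_shift (@open (one_seq S))) => //.
move=> _ [U oU <-]; rewrite setTI; apply: sub_sigma_algebra.
by apply: open_comp => // x _; exact: one_shift_continuous.
Qed.

HB.instance Definition _ :=
  isMeasurableFun.Build _ _ _ _ one_shift measurable_one_shift.

Lemma cylinder_cons s b :
  cylinder (s :: b) = [set x | x 0%N = s] `&` one_shift @^-1` cylinder b.
Proof.
apply/seteqP; split=> x; rewrite /cylinder /mkseq /= -[1%N]addn0 iotaDl -map_comp.
  by case=> <- xb; split => //; rewrite -[RHS]xb.
by case=> <- xb; congr cons; rewrite -[RHS]xb.
Qed.

Lemma measurable_cylinder a : measurable (cylinder a).
Proof.
elim: a => [|s b mb].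
  by rewrite (_ : cylinder [::] = setT) //; apply/seteqP; split.
rewrite cylinder_cons; apply: measurableI.
  by apply: sub_sigma_algebra; exact: (open_coordinate 0 [set s]).
by rewrite -[_ @^-1` _]setTI; exact: measurable_one_shift.
Qed.

(* tau_s(mu) is the law of the shifted sequence under mu conditioned on
   C(s); it is used only when mu(C(s)) > 0. *)
Definition tau (s : S) mu : probability (borel (one_seq S)) R :=
  distribution (mnormalize (mrestr mu (measurable_cylinder [:: s])) mu) one_shift.

Lemma tauE s mu b : (0 < mu (cylinder [:: s]))%E ->
  tau s mu (cylinder b) =
  (fine (mu (cylinder (s :: b))) / fine (mu (cylinder [:: s])))%:E.
Proof.
move=> mus; have fin a : mu (cylinder a) \is a fin_num.
  by apply: fin_num_measure; exact: measurable_cylinder.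
rewrite (_ : tau s mu _ = mnormalize (mrestr mu (measurable_cylinder [:: s])) mu
                            (one_shift @^-1` cylinder b)) //.
rewrite /mnormalize /= /mrestr setTI gt_eqF //=.
rewrite -[_ == +oo%E]negbK -ltey ltey_eq fin /=.
have sbE : one_shift @^-1` cylinder b `&` cylinder [:: s] = cylinder (s :: b).
  rewrite (cylinder_cons s b); apply/seteqP; split=> x [xb x0]; split=> //.
    by case: x0.
  by rewrite /cylinder /= /mkseq /= xb.
by rewrite sbE EFinM fineK.
Qed.

(* The weak* topology is the initial topology of mu |-> (\int f dmu)_f, for f
   ranging over the continuous functions. *)
Definition pairing mu : {ptws continuousType (one_seq S) R -> R} :=
  fun f => (\int[mu]_x f x)%R.

End WeakStar.

Notation weak_star R S := (initial_topology (@pairing R S)).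

Section LambdaGraph.
Context {R : realType} {S : alphabetType}.
Implicit Types (M : set (weak_star R S)) (X : set (bi_seq S)).

Definition transition_complete M :=
  forall mu (s : S), M mu -> (0 < mu (cylinder [:: s]))%E -> M (tau s mu).

Definition in_complete M :=
  forall mu, M mu ->
  exists nu, exists2 s : S, M nu & (0 < nu (cylinder [:: s]))%E /\ tau s nu = mu.

Definition marginal N (mu : weak_star R S) : wvec R S N :=
  [ffun a : N.-tuple S => fine (mu (cylinder a))].

Definition vertices M N : set (wvec R S N) :=
  if N is 0 then [set [ffun=> 1]] else @marginal N @` M.

Definition mass N (s : S) (mu : wvec R S N.+1) : R :=
  \sum_(a : N.+1.-tuple S | thead a == s) mu a.

(* For N = 0 the value is the vertex \emptyset, as mu [tuple s] = mass s mu. *)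
Definition vtau N (s : S) (mu : wvec R S N.+1) : option (wvec R S N) :=
  if 0 < mass s mu
  then Some [ffun b : N.-tuple S => mu [tuple of s :: b] / mass s mu] else None.

Fixpoint vtau_word n N : n.-tuple S -> wvec R S (n + N) -> option (wvec R S N) :=
  match n with
  | 0 => fun _ mu => Some mu
  | n'.+1 => fun a mu =>
      obind (@vtau_word n' N (behead_tuple a)) (@vtau (n' + N) (thead a) mu)
  end.

(* There is a path labeled a from the vertex mu to some vertex of level N. *)
Fixpoint path_from M n N : n.-tuple S -> wvec R S (n + N) -> Prop :=
  match n with
  | 0 => fun _ mu => @vertices M N mu
  | n'.+1 => fun a mu => @vertices M (n' + N).+1 mu /\
      exists2 nu, @vtau (n' + N) (thead a) mu = Some nu &
                  @path_from M n' N (behead_tuple a) nu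
  end.

(* Only nonempty words are compared, so that the empty set of measures
   presents the empty subshift. *)
Definition presents M X :=
  forall n (a : n.+1.-tuple S),
    admissible X a <-> exists N mu, @path_from M n.+1 N a mu.

Definition euclidean_dist N (p q : wvec R S N) : R :=
  Num.sqrt (\sum_(a : N.-tuple S) (p a - q a) ^+ 2).

(* Only used for sets of probability vectors, which are bounded. *)
Definition diameter N (A : set (wvec R S N)) : R :=
  sup [set r | exists p q, [/\ A p, A q & r = euclidean_dist p q]].

Definition contractive M X :=
  forall u, left_inf X u ->
  (fun n => diameter
     [set nu : wvec R S 1 | exists2 mu, @vertices M (n + 1) mu &
                                        vtau_word (recent u n) mu = Some nu])
    @ \oo --> (0 : R).

End LambdaGraph.

Arguments vertices {R S} M N.

(* Main.v *)
(* The conditional one-step distributions of the measures in M given the past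
   x^-_(-n,0] form a decreasing sequence of nonempty sets, whose diameters tend
   to 0 by contractivity; g(x^-, .) is their common limit. The n-th set depends
   only on n letters of x^-, which makes g continuous.
   If rho_n in M is of the form tau_{x^-_(-n,0]}(nu_n) with nu_n in M, then, by
   induction on the word w, the probabilities rho_n(C(w)) converge to those
   prescribed by g and x^-. The constant sequence rho_n = mu, where x^- is
   obtained by repeated in-completeness, gives M_N <= M_N(X, g). For the
   converse, fix x^-, choose any such rho_n and take a cluster point in M. *)
From HB Require Import structures.
Require Import Defs.
From mathcomp Require Import all_boot all_order all_algebra.
From mathcomp Require Import all_classical all_reals all_analysis.
From mathcomp Require Import zify lra.

Set Implicit Arguments.
Unset Strict Implicit.
Unset Printing Implicit Defensive.

Import Order.TTheory GRing.Theory Num.Theory.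
Import numFieldNormedType.Exports.

Local Open Scope classical_set_scope.
Local Open Scope ring_scope.

(** * Finite pasts of one-sided sequences *)

Section Words.
Context {S : alphabetType}.
Implicit Types (u : one_seq S) (w : seq S).

Lemma cylinder_cat w b (x : one_seq S) :
  cylinder (w ++ b) x <->
  cylinder w x /\ mkseq (fun i => x (size w + i)%N) (size b) = b.
Proof.
rewrite /cylinder /= /mkseq size_cat iotaD map_cat add0n.
rewrite -[X in iota X (size b)]addn0 iotaDl -map_comp; split.
  by move/eqP; rewrite eqseq_cat ?size_map ?size_iota// => /andP[/eqP ? /eqP].
by case=> + e; rewrite -[X in _ = _ ++ X]e => ->.
Qed.

(** The word $x_{-n+1}\dots x_0$, oldest letter first, as a plain [seq]: concatenating it with other
    words then involves no dependent lengths. *)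
Definition past u n : seq S := rev (mkseq u n).

Lemma size_past u n : size (past u n) = n.
Proof. by rewrite size_rev size_mkseq. Qed.

Lemma pastS u n : past u n.+1 = u n :: past u n.
Proof. by rewrite /past /mkseq -addn1 iotaD map_cat rev_cat. Qed.

Lemma past_push u s n : past (push u s) n.+1 = rcons (past u n) s.
Proof. by elim: n => // n IHn; rewrite pastS IHn /= pastS. Qed.

(** Turns estimates for the past [extend u w] into estimates for the words [past u n ++ w]. *)
Lemma past_extend u w n : past (extend u w) (n + size w) = past u n ++ w.
Proof.
elim/last_ind: w n => [|w s IHw] n; first by rewrite addn0 cats0.
by rewrite size_rcons addnS /extend foldl_rcons past_push IHw rcons_cat.
Qed.

Lemma nth_past u n i : (i < n)%N -> nth point (past u n) i = u (n.-1 - i)%N.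
Proof.
by move=> ltin; rewrite nth_rev ?size_mkseq// nth_mkseq ?ltn_subLR//;
  case: n ltin => // n ltin; rewrite ?subSS// addSn ltnS leq_addl.
Qed.

Lemma val_recent u n : recent u n = past u n :> seq S.
Proof.
apply: (@eq_from_nth _ point) => [|i]; rewrite size_tuple ?size_past// => ltin.
by rewrite nth_past// -(tnth_nth _ _ (Ordinal ltin)) tnth_mktuple /= subnS -predn_sub.
Qed.

End Words.

(** * Cylinder probabilities, and transitions expressed through them *)

Section CylinderMass.
Context {R : realType} {S : alphabetType}.
Implicit Types (mu nu : weak_star R S) (w b : seq S).

Definition cyl_mass mu w : R := fine (mu (cylinder w)).

Lemma cyl_massE mu w : mu (cylinder w) = (cyl_mass mu w)%:E.
Proof. by rewrite fineK// fin_num_measure//; exact: measurable_cylinder. Qed.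

Lemma cyl_mass_ge0 mu w : 0 <= cyl_mass mu w.
Proof. by rewrite fine_ge0. Qed.

Lemma cyl_mass_nil mu : cyl_mass mu [::] = 1.
Proof.
rewrite /cyl_mass (_ : cylinder [::] = setT) ?probability_setT//.
by apply/seteqP; split.
Qed.

Lemma cyl_mass_cat_le mu w b : cyl_mass mu (w ++ b) <= cyl_mass mu w.
Proof.
rewrite -lee_fin -!cyl_massE; apply: le_measure; rewrite ?inE//;
  try exact: measurable_cylinder.
by move=> x /cylinder_cat[].
Qed.

(** The cylinders of the words [w ++ b] partition that of [w]. *)
Lemma cyl_mass_sum mu w N : \sum_(b : N.-tuple S) cyl_mass mu (w ++ b) = cyl_mass mu w.
Proof.
apply: EFin_inj; rewrite -sumEFin -cyl_massE.
under eq_bigr do rewrite -cyl_massE.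
rewrite fsbig_seq ?index_enum_uniq//=.
rewrite (_ : [set` index_enum _] = [set: N.-tuple S]); last first.
  by apply/seteqP; split=> // b _; rewrite /= mem_index_enum.
rewrite -measure_fin_bigcup//.
- congr (mu _); apply/seteqP; split=> [x [b _ /cylinder_cat[]//]|x wx].
  pose y i := x (size w + i)%N.
  exists (Tuple (introT eqP (size_mkseq y N))) => //; apply/cylinder_cat; split=> //.
  by rewrite [X in mkseq _ X](size_mkseq y N).
- exact: finite_finset.
- move=> b c _ _ [x [/cylinder_cat[_ +] /cylinder_cat[_]]].
  by rewrite !size_tuple => + bE; rewrite bE => /val_inj.
- by move=> b _; exact: measurable_cylinder.
Qed.

Lemma cyl_mass_sum_rcons mu w : \sum_s cyl_mass mu (rcons w s) = cyl_mass mu w.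
Proof.
rewrite -(cyl_mass_sum mu w 1) (reindex (fun s : S => [tuple s])); last first.
  exists (@thead _ _) => [//|] b _.
  by case/tupleP: b => s b; rewrite theadE (tuple0 b); exact: val_inj.
by apply: eq_bigr => s _; rewrite cats1.
Qed.

Lemma cyl_mass_tau mu s b : 0 < cyl_mass mu [:: s] ->
  cyl_mass (tau s mu) b = cyl_mass mu (s :: b) / cyl_mass mu [:: s].
Proof. by move=> mus; rewrite /cyl_mass tauE ?cyl_massE ?lte_fin. Qed.

(** Iterate [tau] along the letters of [w]; the normalizing quotients telescope. The measure
    $\tau_w(\mu)$ is described only by its cylinder masses. *)
Lemma transition_complete_word (M : set (weak_star R S)) mu w :
  transition_complete M -> M mu -> 0 < cyl_mass mu w ->
  exists2 nu, M nu & forall b, cyl_mass nu b = cyl_mass mu (w ++ b) / cyl_mass mu w.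
Proof.
move=> tM; elim: w mu => [|s w IHw] mu Mmu mw.
  by exists mu => // b; rewrite cyl_mass_nil divr1.
have ms : 0 < cyl_mass mu [:: s].
  by apply: lt_le_trans mw _; exact: (cyl_mass_cat_le mu [:: s] w).
have Mtau : M (tau s mu) by apply: tM => //; rewrite cyl_massE lte_fin.
case: (IHw _ Mtau); rewrite ?cyl_mass_tau ?divr_gt0// => nu Mnu nuE.
exists nu => // b; rewrite nuE !cyl_mass_tau//.
by rewrite -mulf_div divff ?mulr1// invr_neq0// gt_eqF.
Qed.

(** Taking marginals commutes with transitions, so paths in the graph can be followed at the level
    of measures. *)
Lemma vtau_marginal N s mu :
  vtau s (marginal N.+1 mu) =
  if 0 < cyl_mass mu [:: s] then Some (marginal N (tau s mu)) else None.
Proof.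
have massE : mass s (marginal N.+1 mu) = cyl_mass mu [:: s].
  rewrite -(cyl_mass_sum mu [:: s] N) /mass.
  rewrite (reindex (fun b : N.-tuple S => [tuple of s :: b])) /=; last first.
    exists (fun a => behead_tuple a) => [b _|a /eqP <-].
      exact: val_inj.
    by rewrite -tuple_eta.
  apply: eq_big => [b|b _]; first by rewrite theadE eqxx.
  by rewrite ffunE.
rewrite /vtau massE; case: ifP => // ms; congr Some; apply/ffunP => b.
by rewrite !ffunE -/(cyl_mass _ _) -/(cyl_mass _ _) cyl_mass_tau.
Qed.

Lemma verticesE (M : set (weak_star R S)) N : (0 < N)%N ->
  vertices M N = @marginal _ _ N @` M.
Proof. by case: N. Qed.

Lemma vtau_word_marginal n N (a : n.-tuple S) mu :
  vtau_word a (marginal (n + N) mu) =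
  if 0 < cyl_mass mu a
  then Some [ffun b : N.-tuple S => cyl_mass mu (a ++ b) / cyl_mass mu a]
  else None.
Proof.
elim: n a mu => [|n IHn] a mu.
  rewrite (tuple0 a) /= cyl_mass_nil ltr01; congr Some; apply/ffunP => b.
  by rewrite !ffunE divr1.
case/tupleP: a => s a; rewrite /= theadE vtau_marginal.
case: ltP => [ms|ms] /=; last first.
  by rewrite ltNge (le_trans (cyl_mass_cat_le mu [:: s] a)).
have -> : behead_tuple [tuple of s :: a] = a by exact: val_inj.
rewrite IHn cyl_mass_tau// pmulr_lgt0 ?invr_gt0//; case: ifP => // ma; congr Some.
apply/ffunP => b; rewrite !ffunE !cyl_mass_tau//.
by rewrite -mulf_div divff ?mulr1// invr_neq0// gt_eqF.
Qed.

(** By transition completeness every vertex reached is again the marginal of a measure in [M], so a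
    path continues exactly as long as the word read has positive mass. *)
Lemma path_from_marginal (M : set (weak_star R S)) n N (a : n.-tuple S) mu :
  transition_complete M -> M mu ->
  path_from M a (marginal (n + N) mu) <-> 0 < cyl_mass mu a.
Proof.
move=> tM; elim: n a mu => [|n IHn] a mu Mmu.
  rewrite (tuple0 a) cyl_mass_nil ltr01; split=> // _ /=.
  case: N => [|N]; last by exists mu.
  (* At level 0 the marginal is the constant vector 1, the total mass. *)
  apply/ffunP => b; rewrite !ffunE; rewrite (tuple0 b).
  exact: cyl_mass_nil.
case/tupleP: a => s a; rewrite /= theadE vtau_marginal.
have -> : behead_tuple [tuple of s :: a] = a by exact: val_inj.
case: ltP => [ms|ms]; split.
- move=> [_ [_ [<-]]]; have Mtau : M (tau s mu).
    by apply: tM => //; rewrite cyl_massE lte_fin.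
  by move/(IHn _ _ Mtau); rewrite cyl_mass_tau// pmulr_lgt0// invr_gt0.
- move=> ma; split; first by exists mu.
  eexists; first by [].
  apply/IHn; first by apply: tM => //; rewrite cyl_massE lte_fin.
  by rewrite cyl_mass_tau// divr_gt0.
- by case=> _ [].
- by rewrite ltNge (le_trans (cyl_mass_cat_le mu [:: s] a)).
Qed.

End CylinderMass.

(** * Topology of the sequence spaces, shift invariance, and followers as plain words *)

Section BiSeq.
Context {S : alphabetType}.
Implicit Types (X : set (bi_seq S)) (u : one_seq S) (w : seq S).

Lemma compact_bi_seq : compact [set: bi_seq S].
Proof.
rewrite (_ : [set: bi_seq S] =
  [set f | forall i : int, [set: discrete_topology S] (f i)]).
  apply: (@tychonoff int (fun=> discrete_topology S) (fun=> setT)) => i.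
  by apply: finite_compact; exact: (@finite_finset S).
by apply/seteqP; split.
Qed.

Lemma near_bi_seq (x : bi_seq S) (j : int) : \forall y \near x, y j = x j.
Proof.
have := @proj_continuous int (fun=> discrete_topology S) j x.
move=> /(_ [set x j]); apply.
exact: (@discrete_set1 (discrete_topology S) (x j)).
Qed.

Lemma near_one_seq u n : \forall v \near u, past v n = past u n.
Proof.
elim: n => [|n IHn]; first exact: (@filterE _ (nbhs u)).
have un : \forall v \near u, v n = u n.
  apply: (@open_nbhs_nbhs (one_seq S) u).
  by split=> //; exact: (open_coordinate n [set u n]).
by near=> v; rewrite !pastS; congr cons; near: v.
Unshelve. all: by end_near.
Qed.

Lemma subshift_shift X x (j : int) : subshift X -> X x -> X (fun i => x (i + j)).
Proof.
case=> _ XE; have shiftX y : X y -> X (fun i => y (i + 1)).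
  by move=> Xy; rewrite -XE; exists y.
have unshiftX y : X y -> X (fun i => y (i - 1)).
  rewrite -[in X y]XE => -[z Xz <-].
  rewrite (_ : (fun _ => _) = z)//; apply/funext => i.
  by rewrite /bi_shift subrK.
elim/int_rect: j x => [|n IHn|n IHn] x Xx.
- by rewrite (_ : (fun _ => _) = x)//; apply/funext => i; rewrite addr0.
- have := shiftX _ (IHn _ Xx); congr X; apply/funext => i.
  by congr x; lia.
- have := unshiftX _ (IHn _ Xx); congr X; apply/funext => i.
  by congr x; lia.
Qed.

Definition followed X u w := exists2 x, X x &
  (forall k : nat, x (- k%:Z) = u k) /\
  (forall i, (i < size w)%N -> x i.+1%:Z = nth point w i).

Lemma followerE X u n (b : n.-tuple S) : follower X u b <-> followed X u b.
Proof.
split=> -[x Xx [xu xb]]; exists x => //; split=> // i.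
  by rewrite size_tuple => ltin; rewrite (xb (Ordinal ltin)) (tnth_nth point).
by rewrite (tnth_nth point) xb ?size_tuple.
Qed.

Lemma left_infE X u : left_inf X u <-> followed X u [::].
Proof. by split=> -[x Xx]; [move=> xu; exists x|case=> xu _; exists x]. Qed.

End BiSeq.

(** * Words of positive mass and the points of the subshift *)

Section Charged.
Context {R : realType} {S : alphabetType}.
Variables (M : set (weak_star R S)) (X : set (bi_seq S)).
Hypotheses (tM : transition_complete M) (sX : subshift X) (MX : presents M X).
Implicit Types (u : one_seq S) (w : seq S).

Definition charged w := exists2 nu, M nu & 0 < cyl_mass nu w.

Lemma charged_catl a b : charged (a ++ b) -> charged a.
Proof.
case=> nu Mnu nuab; exists nu => //.
by apply: lt_le_trans nuab _; exact: cyl_mass_cat_le.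
Qed.

(** If $\nu$ charges [a ++ b], then $\tau_a(\nu)$ charges [b]. *)
Lemma charged_catr a b : charged (a ++ b) -> charged b.
Proof.
case=> nu Mnu nuab; have nua := lt_le_trans nuab (cyl_mass_cat_le nu a b).
have [mu Mmu muE] := transition_complete_word tM Mnu nua.
by exists mu => //; rewrite muE divr_gt0.
Qed.

(** Stated for nonempty words because [presents] compares only these. *)
Lemma admissibleP s w : admissible X [tuple of s :: in_tuple w] <-> charged (s :: w).
Proof.
rewrite MX; split=> [[N [mu pmu]]|[nu Mnu nuw]].
  have [nu Mnu muE] : @vertices _ _ M ((size w).+1 + N) mu by case: pmu.
  by move: pmu; rewrite -muE => /(path_from_marginal _ _ tM Mnu) ?; exists nu.
by exists 0%N, (marginal _ nu); apply/path_from_marginal.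
Qed.

(** Windows of a point are admissible, hence charged. Conversely, points of [X] that show longer and
    longer pasts followed by [w] have a cluster point in [X], by compactness, and it shows the whole
    past and [w]. *)
Lemma followedP u w : followed X u w <-> forall n, charged (past u n ++ w).
Proof.
split=> [[x Xx [xu xw]] n|uw].
  (* The additional oldest letter makes the word nonempty. *)
  apply: (@charged_catr [:: u n]); rewrite -[_ ++ _]/((u n :: past u n) ++ w).
  rewrite cat_cons; apply/admissibleP; exists x => //; exists (- n%:Z) => -[i lti].
  rewrite (tnth_nth point) /= -cat_cons -pastS nth_cat size_past.
  case: ltnP => lein.
    rewrite nth_past//= -xu; congr x; lia.
  have i_n : (i - n.+1 < size w)%N.
    by move: lti; rewrite size_cat size_past; lia.
  rewrite -xw//; congr x; lia.
have adm n : exists y : bi_seq S, X y /\ ((forall k, (k <= n)%N -> y (- k%:Z) = u k) /\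
    (forall i, (i < size w)%N -> y i.+1%:Z = nth point w i)).
  (* With [n.+1] letters the past is nonempty and reaches back to coordinate $-n$. *)
  have := uw n.+1; rewrite pastS cat_cons => /admissibleP[x Xx [j xj]].
  have {}xj i : (i < n.+1 + size w)%N -> x (j + i%:Z) = nth point (past u n.+1 ++ w) i.
    move=> lti; have lti' : (i < (size (past u n ++ w)).+1)%N.
      by rewrite size_cat size_past.
    by rewrite (xj (Ordinal lti')) (tnth_nth point) /= pastS.
  (* The occurrence starts at [j], so the last letter of the past stands at [j + n]; the shift moves
     it to coordinate 0. *)
  exists (fun i => x (i + (j + n%:Z))); split.
    exact: (subshift_shift (j + n%:Z) sX Xx).
  split=> [k lekn|i ltiw].
    rewrite (_ : - k%:Z + _ = j + (n - k)%N%:Z); last lia.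
    rewrite xj; last lia.
    rewrite nth_cat size_past ifT; last lia.
    by rewrite nth_past; [congr u; lia|lia].
  rewrite (_ : i.+1%:Z + _ = j + (n.+1 + i)%N%:Z); last lia.
  rewrite xj; last lia.
  rewrite nth_cat size_past ifF; last lia.
  by rewrite addKn.
have {adm}[y yP] := choice adm.
have cX : compact X.
  by apply: (subclosed_compact (proj1 sX) compact_bi_seq).
have yX : (y @ \oo) X by exists 0%N => // n _; case: (yP n).
have [x [Xx clx]] := cX (y @ \oo) _ yX.
(* Fixing one coordinate defines a neighbourhood, so the cluster point inherits each eventually
   constant coordinate. *)
have yx (j : int) (s : S) : (\forall n \near \oo, y n j = s) -> x j = s.
  move=> yj; have [z [zs <-]] := clx [set z | z j = s] _ yj (near_bi_seq x j).
  exact: zs.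
exists x => //; split=> [k|i ltiw]; apply: yx.
  by exists k => // n /= lekn; case: (yP n) => _ [-> ].
by apply: nearW => n; case: (yP n) => _ [_ ->].
Qed.

Lemma followed_catl u a b : followed X u (a ++ b) -> followed X u a.
Proof.
move/followedP => uab; apply/followedP => n.
by apply: charged_catl; rewrite -catA; exact: uab.
Qed.

Lemma followed_extend u w : followed X u w -> left_inf X (extend u w).
Proof.
move/followedP => uw; apply/left_infE/followedP => n; rewrite cats0.
have := uw n; rewrite -past_extend.
elim: (size w) => [|m IHm]; first by rewrite addn0.
by rewrite addnS pastS -cat1s => /charged_catr.
Qed.

End Charged.

(** * Conditional one-step distributions and their limit *)

Lemma euclidean_dist_ge (R : realType) (S : alphabetType) N (p q : wvec R S N) a :
  `|p a - q a| <= euclidean_dist p q.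
Proof.
rewrite -sqrtr_sqr ler_wsqrtr// (bigD1 a)//= lerDl.
by apply: sumr_ge0 => b _; exact: sqr_ge0.
Qed.

Section ConditionalLimit.
Context {R : realType} {S : alphabetType}.
Variables (M : set (weak_star R S)) (X : set (bi_seq S)).
Hypotheses (tM : transition_complete M) (sX : subshift X) (MX : presents M X).
Implicit Types (mu nu : weak_star R S) (u : one_seq S) (w : seq S).

Definition spread u n : R := diameter
  [set nu : wvec R S 1 | exists2 mu, @vertices _ _ M (n + 1) mu &
                                     vtau_word (recent u n) mu = Some nu].

Definition cond_mass nu u n s :=
  cyl_mass nu (rcons (past u n) s) / cyl_mass nu (past u n).

Lemma cond_mass_ge0 nu u n s : 0 <= cond_mass nu u n s.
Proof. by rewrite divr_ge0// cyl_mass_ge0. Qed.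

Lemma cond_mass_le1 nu u n s : cond_mass nu u n s <= 1.
Proof.
have := cyl_mass_ge0 nu (past u n); rewrite le_eqVlt => /predU1P[e|nu0].
  (* A past of mass 0 gives the value 0, as the inverse of 0 is 0. *)
  by rewrite /cond_mass -e invr0 mulr0.
by rewrite ler_pdivrMr// mul1r -cats1 cyl_mass_cat_le.
Qed.

Lemma cond_mass_sum nu u n : 0 < cyl_mass nu (past u n) ->
  \sum_s cond_mass nu u n s = 1.
Proof.
by move=> nu0; rewrite -mulr_suml cyl_mass_sum_rcons divff// gt_eqF.
Qed.

(** Both distributions are endpoints of paths labeled by the past, hence members of the set whose
    diameter is [spread u n]. *)
Lemma cond_mass_dist nu nu' u n s : M nu -> M nu' ->
  0 < cyl_mass nu (past u n) -> 0 < cyl_mass nu' (past u n) ->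
  `|cond_mass nu u n s - cond_mass nu' u n s| <= spread u n.
Proof.
move=> Mnu Mnu' nu0 nu0'.
pose p mu : wvec R S 1 := [ffun b => cond_mass mu u n (thead b)].
have vp mu : vtau_word (recent u n) (marginal (n + 1) mu) =
             if 0 < cyl_mass mu (past u n) then Some (p mu) else None.
  rewrite vtau_word_marginal val_recent; case: ifP => // _; congr Some.
  apply/ffunP => b; rewrite !ffunE; case/tupleP: b => t b.
  by rewrite theadE (tuple0 b) /= cats1.
have n1_gt0 : (0 < n + 1)%N by rewrite addn1.
have {1}-> : cond_mass nu u n s = p nu [tuple s] by rewrite ffunE.
have -> : cond_mass nu' u n s = p nu' [tuple s] by rewrite ffunE.
apply: le_trans (euclidean_dist_ge _ _ _) _; apply: ub_le_sup.
  (* The supremum dominates its members only if the set is bounded above; all coordinates lie in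
     $[0,1]$, so each squared difference is at most 1. *)
  exists (Num.sqrt (\sum_(a : 1.-tuple S) 1)) => _ [q [q' [+ + ->]]].
  rewrite !(verticesE _ n1_gt0) => -[_ [mu Mmu <-]].
  rewrite vp; case: ifP => // _ [<-].
  move=> [_ [mu' Mmu' <-]]; rewrite vp; case: ifP => // _ [<-].
  rewrite ler_wsqrtr// ler_sum// => b _; rewrite !ffunE.
  rewrite -real_normK ?num_real// expr_le1// ler_norml.
  have := cond_mass_le1 mu u n (thead b); have := cond_mass_le1 mu' u n (thead b).
  have := cond_mass_ge0 mu u n (thead b); have := cond_mass_ge0 mu' u n (thead b).
  lra.
exists (p nu), (p nu'); split=> //.
  by exists (marginal (n + 1) nu); [rewrite verticesE//; exists nu|rewrite vp nu0].
by exists (marginal (n + 1) nu'); [rewrite verticesE//; exists nu'|rewrite vp nu0'].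
Qed.

(** The sets of conditional distributions decrease with the past: writing [past u p] as
    [w ++ past u n], replace $\nu$ by $\tau_w(\nu)$. *)
Lemma cond_mass_past nu u n p : (n <= p)%N -> M nu -> 0 < cyl_mass nu (past u p) ->
  exists2 nu', M nu' & 0 < cyl_mass nu' (past u n) /\
    forall s, cond_mass nu' u n s = cond_mass nu u p s.
Proof.
move=> lenp Mnu nup.
have [w wE] : exists w, past u p = w ++ past u n.
  elim: p lenp {nup} => [|p IHp]; first by rewrite leqn0 => /eqP->; exists [::].
  rewrite leq_eqVlt => /predU1P[->|/IHp[w wE]]; first by exists [::].
  by exists (u p :: w); rewrite pastS wE.
have nuw : 0 < cyl_mass nu w.
  by rewrite wE in nup; apply: lt_le_trans nup (cyl_mass_cat_le _ _ _).
have [nu' Mnu' nuE] := transition_complete_word tM Mnu nuw.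
exists nu' => //; split=> [|s]; first by rewrite nuE -wE divr_gt0.
rewrite /cond_mass !nuE wE rcons_cat.
by rewrite -mulf_div divff ?mulr1// invr_neq0// gt_eqF.
Qed.

(** Some [past u n ++ w] is uncharged by [followedP], and then so is every word obtained by
    lengthening the past. *)
Lemma uncharged_near u w : ~ followed X u w ->
  \forall n \near \oo, forall nu, M nu -> cyl_mass nu (past u n ++ w) = 0.
Proof.
move=> uw; have /existsNP[n un] : ~ forall n, charged M (past u n ++ w).
  by move=> /(followedP tM sX MX).
exists n => // p /= lenp nu Mnu; apply: contra_notP un => /eqP nu0.
have : charged M (past u p ++ w).
  by exists nu => //; rewrite lt_neqAle eq_sym nu0 cyl_mass_ge0.
elim: p lenp {nu0} => [|p IHp]; first by rewrite leqn0 => /eqP->.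
rewrite leq_eqVlt => /predU1P[->//|/IHp + ch]; apply.
by move: ch; rewrite pastS -cat1s -catA => /charged_catr; apply.
Qed.

Lemma left_inf_charged u : left_inf X u ->
  forall n, exists nu, M nu /\ 0 < cyl_mass nu (past u n).
Proof.
move=> /left_infE/(followedP tM sX MX) Xu n; have := Xu n.
by rewrite cats0 => -[nu]; exists nu.
Qed.

Hypothesis ctrM : contractive M X.

Lemma spread_cvg0 u : left_inf X u -> spread u n @[n --> \oo] --> 0.
Proof. exact: ctrM. Qed.

(** Pick any $\nu_p$ charging the past of length $p$. Nestedness puts its distribution within
    [spread u n] of every distribution at level $n\le p$, so the sequence is Cauchy; letting
    $p\to\infty$ with $n$ fixed gives the bound. *)
Lemma cond_mass_lim u : left_inf X u ->
  exists h : S -> R, forall n nu s, M nu -> 0 < cyl_mass nu (past u n) ->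
    `|cond_mass nu u n s - h s| <= spread u n.
Proof.
move=> Xu; have spread0 := spread_cvg0 Xu.
have [nu_ nuP] := choice (left_inf_charged Xu).
have near_spread n p nu s : (n <= p)%N -> M nu -> 0 < cyl_mass nu (past u n) ->
    `|cond_mass nu u n s - cond_mass (nu_ p) u p s| <= spread u n.
  move=> lenp Mnu nu0; have [Mp p0] := nuP p.
  have [nu' Mnu' [nu'0 <-]] := cond_mass_past lenp Mp p0.
  exact: cond_mass_dist.
have cvgs s : cvg (cond_mass (nu_ n) u n s @[n --> \oo]).
  apply/cauchy_cvgP/cauchy_exP => e e0.
  have /cvgrPdist_lt/(_ _ e0)[n _ ltn] := spread0.
  exists (cond_mass (nu_ n) u n s); exists n => // p /= lenp.
  have [Mn n0] := nuP n; apply: le_lt_trans (near_spread _ _ _ s lenp Mn n0) _.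
  have := ltn n (leqnn n); rewrite /= sub0r normrN; apply: le_lt_trans.
  exact: ler_norm.
exists (fun s => lim (cond_mass (nu_ n) u n s @[n --> \oo])) => n nu s Mnu nu0.
have cvgd : `|cond_mass nu u n s - cond_mass (nu_ p) u p s| @[p --> \oo] -->
    `|cond_mass nu u n s - lim (cond_mass (nu_ n) u n s @[n --> \oo])|.
  by apply: cvg_norm; apply: cvgB; [exact: cvg_cst|exact: cvgs].
rewrite -(cvg_lim _ cvgd)//; apply: limr_le.
  by apply/cvg_ex; eexists; exact: cvgd.
by exists n => // p /= lenp; exact: near_spread.
Qed.

Definition cond_limit (h : one_seq S -> S -> R) :=
  forall u, left_inf X u -> forall n nu s, M nu -> 0 < cyl_mass nu (past u n) ->
    `|cond_mass nu u n s - h u s| <= spread u n.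

Lemma cond_limit_exists : exists h, cond_limit h.
Proof.
have ex u : exists h : S -> R, left_inf X u -> forall n nu s, M nu ->
    0 < cyl_mass nu (past u n) -> `|cond_mass nu u n s - h s| <= spread u n.
  have [Xu|nXu] := pselect (left_inf X u); last by exists (fun=> 0).
  by have [h hP] := cond_mass_lim Xu; exists h.
by have [h hP] := choice ex; exists h.
Qed.

Variable h : one_seq S -> S -> R.
Hypothesis hP : cond_limit h.

(** Clearing the denominator extends the bound to pasts of mass 0; the absolute value makes the
    factor nonnegative, as later monotonicity steps require. *)
Lemma cond_limit_mul u n nu s : left_inf X u -> M nu ->
  `|cyl_mass nu (rcons (past u n) s) - cyl_mass nu (past u n) * h u s| <=
  `|spread u n| * cyl_mass nu (past u n).
Proof.
move=> Xu Mnu; have := cyl_mass_ge0 nu (past u n).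
rewrite le_eqVlt => /predU1P[nu0|nu0].
  have := cyl_mass_cat_le nu (past u n) [:: s]; rewrite cats1 -nu0.
  by rewrite mul0r mulr0 subr0 ger0_norm// cyl_mass_ge0.
have /le_trans/(_ (ler_norm _)) := hP Xu s Mnu nu0.
rewrite -(ler_pM2r nu0); apply: le_trans.
rewrite -[X in _ <= _ * X](gtr0_norm nu0) -normrM mulrBl divfK ?gt_eqF//.
by rewrite [h u s * _]mulrC.
Qed.

(** Realizes [h u] as a limit of conditional distributions, from which its range, support and total
    mass are inherited. *)
Lemma cond_limit_cvg u : left_inf X u ->
  exists2 nu_ : nat -> weak_star R S,
    forall n, M (nu_ n) /\ 0 < cyl_mass (nu_ n) (past u n) &
    forall s, cond_mass (nu_ n) u n s @[n --> \oo] --> h u s.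
Proof.
move=> Xu; have [nu_ nuP] := choice (left_inf_charged Xu); exists nu_ => // s.
apply/cvgrPdist_le => e e0.
have /cvgrPdist_le/(_ _ e0)[n _ ltn] := (spread_cvg0 Xu).
exists n => // p /= lenp; have [Mp p0] := nuP p.
rewrite distrC; apply: le_trans (hP Xu s Mp p0) _.
by have := ltn p lenp; rewrite /= sub0r normrN; apply: le_trans; exact: ler_norm.
Qed.

Lemma cond_limit_range u s : left_inf X u -> 0 <= h u s <= 1.
Proof.
move=> Xu; have [nu_ _ cvgh] := cond_limit_cvg Xu.
have cvs : cvg (cond_mass (nu_ n) u n s @[n --> \oo]).
  by apply/cvg_ex; eexists; exact: cvgh.
rewrite -(cvg_lim _ (cvgh s))//; apply/andP; split.
  by apply: limr_ge cvs _; apply: nearW => n; exact: cond_mass_ge0.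
by apply: limr_le cvs _; apply: nearW => n; exact: cond_mass_le1.
Qed.

Lemma cond_limit_unfollowed u s : left_inf X u -> ~ followed X u [:: s] -> h u s = 0.
Proof.
move=> Xu us; have [nu_ nuP cvgh] := cond_limit_cvg Xu.
apply: (cvg_unique _ (cvgh s)) => //; apply: cvg_near_cst.
have := uncharged_near us; apply: filterS => n nu0; have [Mn _] := nuP n.
by rewrite /cond_mass -cats1 nu0// mul0r.
Qed.

Lemma cond_limit_sum u : left_inf X u -> \sum_s h u s = 1.
Proof.
move=> Xu; have [nu_ nuP cvgh] := cond_limit_cvg Xu.
have : \sum_s cond_mass (nu_ n) u n s @[n --> \oo] --> \sum_s h u s.
  by apply: cvg_big => [x|s _]; [exact: add_continuous|exact: cvgh].
move/cvg_unique; apply => //.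
apply: cvg_near_cst; apply: nearW => n.
by rewrite cond_mass_sum//; case: (nuP n).
Qed.

(** Sequences with the same [n] recent letters have the same conditional distributions at level [n],
    and both limits are within the common spread of any one of them. *)
Lemma cond_limit_dist u v n s : left_inf X u -> left_inf X v ->
  past v n = past u n -> `|h u s - h v s| <= spread u n *+ 2.
Proof.
move=> Xu Xv vu; have [nu_ nuP _] := cond_limit_cvg Xu; have [Mn n0] := nuP n.
have svE : spread v n = spread u n.
  rewrite /spread (_ : recent v n = recent u n)//.
  by apply: val_inj; rewrite /= !val_recent.
have := hP Xu s Mn n0; have := @hP v Xv n _ s Mn; rewrite vu svE => /(_ n0).
rewrite /cond_mass vu => hv hu; rewrite mulr2n.
by apply: le_trans (ler_distD _ _ _) (lerD _ hv); rewrite distrC.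
Qed.

Lemma cond_limit_continuous :
  {within @gdomain S X,
    continuous (fun p : one_seq S * discrete_topology S => h p.1 p.2)}.
Proof.
apply/subspace_continuousP => -[u s] [/= Xu _]; apply/cvgrPdist_lt => e e0.
(* A spread below [e / 2] compensates the factor 2 of [cond_limit_dist]. *)
have /cvgrPdist_lt/(_ _ (divr_gt0 e0 (ltr0Sn R 1)))[n _ ltn] := (spread_cvg0 Xu).
have {ltn} := ltn n (leqnn n).
rewrite /= sub0r normrN => /(le_lt_trans (ler_norm _)) ltn.
rewrite near_withinE.
exists ([set v | past v n = past u n], [set s]).
  by split; [exact: near_one_seq|exact: (@discrete_set1 (discrete_topology S) s)].
move=> [v _] [/= vu ->] [/= Xv _].
apply: le_lt_trans (cond_limit_dist s Xu Xv vu) _.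
by rewrite -mulr_natr -ltr_pdivlMr.
Qed.

(* rho = tau_(past u n)(nu) for some nu in M, expressed on cylinders, where
   probabilities on sequences are determined. *)
Definition has_past u n (rho : weak_star R S) := exists nu,
  [/\ M nu, 0 < cyl_mass nu (past u n) &
      forall b, cyl_mass rho b = cyl_mass nu (past u n ++ b) / cyl_mass nu (past u n)].

(** Appending a letter [s] to [w] multiplies the mass by [h (extend u w) s] up to an error at most
    the spread of [extend u w] at level [n + size w]. A word that cannot follow [u] eventually has
    mass 0. *)
Lemma cyl_mass_cvg u (rho : nat -> weak_star R S) w : left_inf X u ->
  (forall n, has_past u n (rho n)) ->
  cyl_mass (rho n) w @[n --> \oo] -->
    if `[< followed X u w >]
    then \prod_(k < size w) h (extend u (take k w)) (nth point w k) else 0.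
Proof.
move=> Xu rhoP; elim/last_ind: w => [|w s IHw].
  rewrite big_ord0 asboolT; last exact/left_infE.
  by under eq_fun do rewrite cyl_mass_nil; exact: cvg_cst.
case: asboolP => [uws|nuws]; last first.
  apply: cvg_near_cst; have := uncharged_near nuws; apply: filterS => n nu0.
  by have [nu [Mnu _ ->]] := rhoP n; rewrite nu0// mul0r.
have uw : followed X u w.
  by apply: (followed_catl tM sX MX (b := [:: s])); rewrite cats1.
rewrite asboolT// in IHw.
have Xuw := followed_extend tM sX MX uw.
rewrite size_rcons big_ord_recr/=.
rewrite -cats1 take_size_cat// nth_cat ltnn subnn/=.
under eq_bigr => k _.
  rewrite takel_cat ?(ltnW (ltn_ord k))// nth_cat ltn_ord.
  over.
have spreadw : spread (extend u w) (n + size w) @[n --> \oo] --> 0.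
  by have := spread_cvg0 Xuw; rewrite -(cvg_shiftn (size w)).
have rest : cyl_mass (rho n) (w ++ [:: s]) -
    cyl_mass (rho n) w * h (extend u w) s @[n --> \oo] --> 0.
  apply/cvgrPdist_le => e e0.
  have /cvgrPdist_le/(_ _ e0)[m _ ltm] := spreadw.
  exists m => // n /= lemn; rewrite sub0r normrN.
  have {ltm} := ltm n lemn; rewrite /= sub0r normrN; apply: le_trans.
  have [nu [Mnu nu0 nuE]] := rhoP n.
  have := cond_limit_mul (n + size w) s Xuw Mnu.
  rewrite past_extend rcons_cat -cats1 => le_nu.
  have -> : cyl_mass (rho n) (w ++ [:: s]) - cyl_mass (rho n) w * h (extend u w) s =
      (cyl_mass nu (past u n ++ w ++ [:: s]) -
       cyl_mass nu (past u n ++ w) * h (extend u w) s) / cyl_mass nu (past u n).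
    by rewrite !nuE mulrBl mulrAC.
  rewrite normrM normfV (gtr0_norm nu0) ler_pdivrMr//.
  (* The error is relative to the mass of [past u n ++ w], at most that of [past u n], which is the
     normalizing factor. *)
  by apply: le_trans le_nu _; rewrite ler_wpM2l// cyl_mass_cat_le.
by apply: (cvg_sub0 rest); apply: cvgM IHw _; exact: cvg_cst.
Qed.

End ConditionalLimit.

(** * Weak* cluster points and infinite pasts of measures *)

Section WeakStarLimits.
Context {R : realType} {S : alphabetType}.
Implicit Types (M : set (weak_star R S)) (u : one_seq S) (w : seq S).

Lemma locally_constant_continuous (T U : topologicalType) (f : T -> U) :
  (forall x, \forall y \near x, f y = f x) -> continuous f.
Proof. by move=> fx x A /nbhs_singleton Afx; apply: filterS (fx x) => y /= ->. Qed.

Lemma past_determined_continuous (f : one_seq S -> R) n :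
  (forall u v, past u n = past v n -> f u = f v) -> continuous f.
Proof.
move=> fn; apply: locally_constant_continuous => u.
by have := near_one_seq u n; apply: filterS => v /fn.
Qed.

(** Typed on the topological space [one_seq S], so that it can serve as a continuous test
    function. *)
Definition indic_cylinder w : one_seq S -> R := \1_(cylinder w : set (one_seq S)).

Lemma indic_cylinder_continuous w : continuous (indic_cylinder w).
Proof.
apply: (@past_determined_continuous _ (size w)) => u v /(can_inj revK) uv.
rewrite /indic_cylinder !indicE.
rewrite (_ : (u \in _) = (v \in (cylinder w : set (one_seq S))))//.
by rewrite -[LHS]/`[< mkseq u (size w) = w >] uv.
Qed.

HB.instance Definition _ w := @isContinuous.Build (one_seq S) R
  (indic_cylinder w) (@indic_cylinder_continuous w).

(** The indicator of a cylinder is continuous, so its integral is one of the coordinates defining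
    the weak* topology. *)
Lemma cyl_mass_continuous w : continuous (cyl_mass^~ w : weak_star R S -> R).
Proof.
pose f : continuousType (one_seq S) R := indic_cylinder w.
rewrite (_ : (cyl_mass^~ w) = proj f \o @pairing R S).
  move=> mu; apply: continuous_comp; first exact: initial_continuous.
  exact: proj_continuous.
apply/funext => mu; rewrite /= /proj /pairing /Rintegral /f /=.
by rewrite integral_indic// ?setIT//; exact: measurable_cylinder.
Qed.

(** A cluster point replaces a convergent subsequence: cylinder masses are continuous and converge
    along [rho], which determines their values at any cluster point. *)
Lemma weak_star_cluster M (rho : nat -> weak_star R S) (G : seq S -> R) :
  compact M -> (forall n, M (rho n)) ->
  (forall w, cyl_mass (rho n) w @[n --> \oo] --> G w) ->
  exists2 mu, M mu & forall w, cyl_mass mu w = G w.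
Proof.
move=> cM Mrho cvgG; have rhoM : (rho @ \oo) M by exists 0%N => // n _; exact: Mrho.
have [mu [Mmu clmu]] := cM (rho @ \oo) (fmap_proper_filter rho _) rhoM.
exists mu => // w; apply/eqP; rewrite -subr_eq0 -normr_le0; apply/ler_addgt0Pl => e e0.
have e20 : 0 < e / 2 by rewrite divr_gt0.
have /cvgrPdist_le/(_ _ e20) near_mu := @cyl_mass_continuous w mu.
have /cvgrPdist_le/(_ _ e20) near_G := cvgG w.
have [nu [+ +]] := clmu [set nu | `|G w - cyl_mass nu w| <= e / 2] _ near_G near_mu.
rewrite /= => Gnu munu; rewrite addr0 (splitr e).
by apply: le_trans (ler_distD (cyl_mass nu w) _ _) (lerD munu _); rewrite distrC.
Qed.

Lemma in_complete_past M mu : in_complete M -> M mu ->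
  exists u, forall n, has_past M u n mu.
Proof.
move=> iM Mmu.
have ex (m : weak_star R S) : exists p : weak_star R S * S, M m ->
    [/\ M p.1, 0 < cyl_mass p.1 [:: p.2] & forall b,
        cyl_mass m b = cyl_mass p.1 (p.2 :: b) / cyl_mass p.1 [:: p.2]].
  have [Mm|nMm] := pselect (M m); last by exists (m, point).
  have [nu [s Mnu [nus taunu]]] := iM _ Mm; exists (nu, s) => _.
  have nus0 : 0 < cyl_mass nu [:: s] by rewrite -lte_fin -cyl_massE.
  by split=> // b; rewrite -cyl_mass_tau// taunu.
have [f fP] := choice ex.
(* [m n] is the chosen [n]-th predecessor of [mu]; the edge from [m n.+1] to [m n] carries the
   letter at time $-n$. *)
pose m n := iter n (fun x => (f x).1) mu.
have Mm n : M (m n) by elim: n => // n IHn; case: (fP _ IHn).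
exists (fun n => (f (m n)).2) => n; exists (m n).
set u : one_seq S := fun n => _.
elim: n => [|n [_ n0 nE]].
  by split=> // [|b]; rewrite ?cyl_mass_nil// divr1.
have [_ s0 sE] := fP _ (Mm n).
have n0' : 0 < cyl_mass (m n.+1) (past u n.+1).
  by rewrite pastS; move: n0; rewrite sE pmulr_lgt0// invr_gt0.
split=> // b; rewrite nE !sE pastS -cat_cons.
by rewrite -mulf_div divff ?mulr1// invr_neq0// gt_eqF.
Qed.

End WeakStarLimits.

Theorem proposition3p1 (R : realType) (S : alphabetType)
    (M : set (weak_star R S)) (X : set (bi_seq S))
    (cM : compact M) (tM : transition_complete M) (iM : in_complete M)
    (sX : subshift X) (MX : presents M X) (ctrM : contractive M X) :
  exists g : one_seq S * discrete_topology S -> R,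
    g_function X g /\ forall N : nat, vertices M N = g_vertices X g N.
Proof.
have [h hP] := cond_limit_exists tM sX MX ctrM.
exists (fun p => h p.1 p.2); split.
  split; first exact: (cond_limit_continuous tM sX MX ctrM hP).
    by move=> [u s] [/= Xu _]; exact: (cond_limit_range tM sX MX ctrM hP).
  move=> u Xu; rewrite -(cond_limit_sum tM sX MX ctrM hP Xu) [RHS]big_mkcond/=.
  (* The sum over followers extends to all letters because [h u] vanishes on the others. *)
  rewrite [LHS]big_mkcond/=; apply: eq_bigr => s _; case: asboolP => // us.
  rewrite (cond_limit_unfollowed tM sX MX ctrM hP)// => Xus.
  by apply: us; split=> //; apply/followerE.
have g_vecE u mu N : left_inf X u ->
    (forall w, cyl_mass mu w = if `[< followed X u w >]
       then \prod_(k < size w) h (extend u (take k w)) (nth point w k) else 0) ->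
    marginal N mu = g_vec X (fun p => h p.1 p.2) N u.
  move=> Xu muE; apply/ffunP => a; rewrite !ffunE -[LHS]/(cyl_mass mu a) muE.
  have -> : `[< followed X u a >] = `[< follower X u a >].
    by apply: asbool_equiv_eq; split=> /followerE.
  case: asboolP => // _; rewrite size_tuple; apply: eq_bigr => k _.
  by rewrite (tnth_nth point).
(* At level 0 both sides are the same singleton by definition. *)
case=> // N; apply/seteqP; split=> [_ [mu Mmu <-]|_ [u Xu <-]].
  have [u uP] := in_complete_past iM Mmu.
  have Xu : left_inf X u.
    apply/left_infE/(followedP tM sX MX) => n; rewrite cats0.
    by have [nu [Mnu nu0 _]] := uP n; exists nu.
  exists u => //; apply/esym/g_vecE => // w.
  have cvg_w := @cyl_mass_cvg _ _ _ _ tM sX MX ctrM _ hP u (fun=> mu) w Xu uP.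
  by apply: cvg_unique cvg_w => //; exact: cvg_cst.
(* Conditioning a measure that charges [past u n] on this word yields a member of [M] with that
   past. *)
have ch n : exists mu, M mu /\ has_past M u n mu.
  have [nu [Mnu nu0]] := left_inf_charged tM sX MX Xu n.
  have [mu Mmu muE] := transition_complete_word tM Mnu nu0.
  by exists mu; split=> //; exists nu.
have [rho rhoP] := choice ch.
have [mu Mmu muE] := weak_star_cluster cM (fun n => proj1 (rhoP n))
  (fun w => @cyl_mass_cvg _ _ _ _ tM sX MX ctrM _ hP u rho w Xu
              (fun n => proj2 (rhoP n))).
by exists mu => //; exact: g_vecE.
Qed.
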